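(* Let $n\ge2$ and let $\Omega\subset\mathbb{H}^n$ be a domain with $\partial_\infty\Omega=\{p\}$ for a single point $p\in\partial_\infty\mathbb{H}^n$. Then for every $\lambda\in[0,(n-1)^2/4]$ there is no nontrivial bounded function $u\in C(\overline\Omega)\cap C^2(\Omega)$ with $-\Delta u=\lambda u$ in $\Omega$ and $u=0$ on $\partial\Omega$.
   Context: $\Delta$ is the Laplace–Beltrami operator of $\mathbb{H}^n$; a domain is an open connected set. $\partial_\infty\mathbb{H}^n$ is the set of classes of unit-speed geodesic rays at bounded distance from one another, and $\partial_\infty\Omega$ is the boundary of $\Omega$ in $\mathbb{H}^n\cup\partial_\infty\mathbb{H}^n$ with the cone topology, minus its boundary in $\mathbb{H}^n$. *)

(* Defs.v *)
(* Model of H^n: the Poincare ball model.  A point of R^n is a function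
   x : nat -> R whose coordinates of index >= n vanish. *)
From Stdlib Require Import Reals.
Open Scope R_scope.

Definition point := nat -> R.

Fixpoint rsum (n : nat) (f : nat -> R) : R :=
  match n with
  | O => 0
  | S k => rsum k f + f k
  end.

Definition inRn (n : nat) (x : point) : Prop := forall i, (n <= i)%nat -> x i = 0.

Definition norm2 (n : nat) (x : point) : R := rsum n (fun i => (x i)^2).
Definition dist2 (n : nat) (x y : point) : R := rsum n (fun i => (x i - y i)^2).

Definition Hn (n : nat) (x : point) : Prop := inRn n x /\ norm2 n x < 1.
(* ideal boundary of H^n = unit sphere; the cone topology on
   H^n ∪ ∂∞H^n is the Euclidean topology of the closed ball *)
Definition ideal_pt (n : nat) (p : point) : Prop := inRn n p /\ norm2 n p = 1.

Definition open_in_Rn (n : nat) (U : point -> Prop) : Prop :=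
  forall x, U x -> exists eps, 0 < eps /\
    forall y, inRn n y -> dist2 n x y < eps^2 -> U y.

Definition connected_set (n : nat) (S : point -> Prop) : Prop :=
  ~ exists U V : point -> Prop,
      open_in_Rn n U /\ open_in_Rn n V /\
      (forall x, S x -> U x \/ V x) /\
      (exists x, S x /\ U x) /\ (exists x, S x /\ V x) /\
      (forall x, S x -> U x -> V x -> False).

Definition domain_Hn (n : nat) (O : point -> Prop) : Prop :=
  (forall x, O x -> Hn n x) /\ (exists x, O x) /\ open_in_Rn n O /\ connected_set n O.

Definition closureE (n : nat) (O : point -> Prop) (x : point) : Prop :=
  inRn n x /\ forall eps, 0 < eps -> exists y, O y /\ dist2 n x y < eps^2.

Definition closureH (n : nat) (O : point -> Prop) (x : point) : Prop :=
  Hn n x /\ closureE n O x.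
Definition boundaryH (n : nat) (O : point -> Prop) (x : point) : Prop :=
  closureH n O x /\ ~ O x.

Definition boundary_inf (n : nat) (O : point -> Prop) (p : point) : Prop :=
  ideal_pt n p /\ closureE n O p.

Definition continuous_on (n : nat) (S : point -> Prop) (f : point -> R) : Prop :=
  forall x, S x -> forall eps, 0 < eps -> exists delta, 0 < delta /\
    forall y, S y -> dist2 n x y < delta^2 -> Rabs (f y - f x) < eps.

Definition upd (x : point) (i : nat) (t : R) : point :=
  fun j => if Nat.eqb j i then t else x j.

Definition has_partial_on (S : point -> Prop) (f : point -> R) (i : nat)
  (g : point -> R) : Prop :=
  forall x, S x -> derivable_pt_lim (fun t => f (upd x i t)) (x i) (g x).

Definition C2_on (n : nat) (S : point -> Prop) (f : point -> R)
  (g : nat -> point -> R) (h : nat -> nat -> point -> R) : Prop :=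
  continuous_on n S f /\
  forall i, (i < n)%nat ->
    has_partial_on S f i (g i) /\ continuous_on n S (g i) /\
    forall j, (j < n)%nat ->
      has_partial_on S (g i) j (h i j) /\ continuous_on n S (h i j).

(* Laplace–Beltrami operator of the Poincare ball metric
   (2/(1-|x|^2))^2 |dx|^2, expressed via the partials g, h:
   Δu = ((1-|x|^2)/2)^2 (Δ_E u + (n-2) (2/(1-|x|^2)) x·∇u) *)
Definition hyp_laplacian (n : nat) (g : nat -> point -> R)
  (h : nat -> nat -> point -> R) (x : point) : R :=
  ((1 - norm2 n x) / 2)^2 *
  (rsum n (fun i => h i i x)
   + (INR n - 2) * (2 / (1 - norm2 n x)) * rsum n (fun i => x i * g i x)).

(* Main.v *)
(* Suppose [u > 0] somewhere. Totally geodesic hyperplanes shrinking to [p] cut off from the domain a part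
   that is relatively compact in H^n, on whose boundary [u] is 0 or (on the hypersurface near [p]) at most M.
   If [L] is proportional to [sinh] of the signed distance to such a hyperplane, then [Delta L = n L] and
   [|grad L|^2 = L^2 + k^2], so the function [F = L^(-b) (2 - k / L)] with [b = (n-1)/2] satisfies
   [Delta F + lam F < 0] for every [lam <= b^2] as soon as [L / k] is large. Hence [u / F] has no positive
   interior maximum, and comparison on the cut-off region bounds [u] by a multiple of [F] which tends to 0
   pointwise as the hyperplanes shrink to [p]. *)
From Stdlib Require Import Reals Lra Lia Psatz Classical FunctionalExtensionality.
From Coquelicot Require Import Coquelicot.
Require Import Defs.
Open Scope R_scope.

(** * Finite sums *)

Lemma rsum_ext n f g :
  (forall i, (i < n)%nat -> f i = g i) -> rsum n f = rsum n g.
Proof.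
  induction n as [|n IH]; intros H; simpl; [reflexivity|].
  rewrite IH by (intros; apply H; lia). now rewrite H by lia.
Qed.

Lemma rsum_plus n f g : rsum n (fun i => f i + g i) = rsum n f + rsum n g.
Proof. induction n as [|n IH]; simpl; [|rewrite IH]; ring. Qed.

Lemma rsum_scal n c f : rsum n (fun i => c * f i) = c * rsum n f.
Proof. induction n as [|n IH]; simpl; [|rewrite IH]; ring. Qed.

Lemma rsum_const n c : rsum n (fun _ => c) = INR n * c.
Proof. induction n as [|n IH]; [simpl; ring|]. rewrite S_INR; simpl; rewrite IH; ring. Qed.

Lemma rsum_le n f g :
  (forall i, (i < n)%nat -> f i <= g i) -> rsum n f <= rsum n g.
Proof.
  induction n as [|n IH]; intros H; simpl; [lra|].
  apply Rplus_le_compat; [apply IH; intros|]; apply H; lia.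
Qed.

Lemma rsum_ge0 n f : (forall i, (i < n)%nat -> 0 <= f i) -> 0 <= rsum n f.
Proof.
  intros H. replace 0 with (rsum n (fun _ => 0)) by (rewrite rsum_const; ring).
  now apply rsum_le.
Qed.

Lemma rsum_term_le n f i :
  (forall j, (j < n)%nat -> 0 <= f j) -> (i < n)%nat -> f i <= rsum n f.
Proof.
  induction n as [|n IH]; intros H Hi; [lia|]. simpl.
  destruct (Nat.eq_dec i n) as [->|Hne].
  - assert (0 <= rsum n f) by (apply rsum_ge0; intros; apply H; lia). lra.
  - assert (f i <= rsum n f) by (apply IH; [intros; apply H|]; lia).
    assert (0 <= f n) by (apply H; lia). lra.
Qed.

(** The summand [F] may depend on the index, so that [norm2], [dot] and [dist2] all become explicit
    functions of one coordinate, ready for differentiation. *)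
Lemma rsum_update n (F : nat -> R -> R) x i t : (i < n)%nat ->
  rsum n (fun j => F j (upd x i t j)) = rsum n (fun j => F j (x j)) - F i (x i) + F i t.
Proof.
  intros Hi. induction n as [|n IH]; [lia|]. simpl.
  destruct (Nat.eq_dec i n) as [->|Hne].
  - rewrite (rsum_ext n (fun j => F j (upd x n t j)) (fun j => F j (x j))).
    + unfold upd at 1. rewrite Nat.eqb_refl. ring.
    + intros j Hj. unfold upd. destruct (Nat.eqb_spec j n); [lia|reflexivity].
  - rewrite IH by lia. unfold upd at 1.
    destruct (Nat.eqb_spec n i); [lia|]. ring.
Qed.

Lemma upd_same x i t : upd x i t i = t.
Proof. unfold upd. now rewrite Nat.eqb_refl. Qed.

Lemma upd_id x i : upd x i (x i) = x.
Proof.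
  apply functional_extensionality; intros j. unfold upd.
  now destruct (Nat.eqb_spec j i) as [->|].
Qed.

Lemma upd_upd x i s t : upd (upd x i s) i t = upd x i t.
Proof.
  apply functional_extensionality; intros j. unfold upd.
  now destruct (Nat.eqb_spec j i).
Qed.

Lemma upd_inRn n x i t : (i < n)%nat -> inRn n x -> inRn n (upd x i t).
Proof.
  intros Hi Hx j Hj. unfold upd. destruct (Nat.eqb_spec j i); [lia|now apply Hx].
Qed.

Lemma dist2_upd n x i t : (i < n)%nat -> dist2 n x (upd x i t) = (x i - t)^2.
Proof.
  intros Hi. unfold dist2.
  rewrite (rsum_update n (fun j s => (x j - s)^2)) by assumption.
  rewrite (rsum_ext n _ (fun _ => 0)) by (intros; ring).
  rewrite rsum_const. ring.
Qed.

Lemma dist2_coord n x y i d : 0 < d -> (i < n)%nat -> dist2 n x y < d^2 -> Rabs (y i - x i) < d.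
Proof.
  intros Hd Hi H.
  assert ((x i - y i)^2 <= dist2 n x y).
  { apply (rsum_term_le n (fun j => (x j - y j)^2)); [intros; apply pow2_ge_0|assumption]. }
  apply Rabs_def1; nra.
Qed.

Lemma dist2_coords n x y d : (forall i, (i < n)%nat -> Rabs (y i - x i) < d) ->
  dist2 n x y <= INR n * d^2.
Proof.
  intros H. rewrite <- rsum_const. apply rsum_le. intros i Hi.
  specialize (H i Hi). apply Rabs_def2 in H. nra.
Qed.

Lemma dist2_triangle n x y z d e : 0 < d -> 0 < e ->
  dist2 n x y < d^2 -> dist2 n y z < e^2 -> dist2 n x z < 2 * (d^2 + e^2).
Proof.
  intros Hd He H1 H2.
  apply Rle_lt_trans with (2 * (dist2 n x y + dist2 n y z)); [|lra].
  unfold dist2. rewrite <- rsum_plus, <- rsum_scal.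
  (* With [a = x i - y i] and [c = y i - z i], the square is
     [(a - c)^2 = 2 a^2 + 2 c^2 - (a + c)^2]. *)
  apply rsum_le. intros i _. pose proof (pow2_ge_0 (x i - 2 * y i + z i)). nra.
Qed.

(** * Continuity *)

Lemma continuous_on_const n S c : continuous_on n S (fun _ => c).
Proof.
  intros x _ eps He. exists 1. split; [lra|]. intros. rewrite Rminus_diag, Rabs_R0. lra.
Qed.

Lemma continuous_on_coord n S i : (i < n)%nat -> continuous_on n S (fun x => x i).
Proof.
  intros Hi x _ eps He. exists eps. split; [assumption|]. intros y _. now apply dist2_coord.
Qed.

(** The one epsilon-delta argument from which the algebraic closure properties below follow, through
    continuity of [phi] on the plane. *)
Lemma continuous_on_comp2 n S (phi : R -> R -> R) f g :
  (forall x, S x -> continuity_2d_pt phi (f x) (g x)) ->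
  continuous_on n S f -> continuous_on n S g -> continuous_on n S (fun x => phi (f x) (g x)).
Proof.
  intros Hphi Hf Hg x Hx eps He.
  destruct (Hphi x Hx (mkposreal eps He)) as [d Hd].
  destruct (Hf x Hx d (cond_pos d)) as [d1 [Hd1 H1]].
  destruct (Hg x Hx d (cond_pos d)) as [d2 [Hd2 H2]].
  exists (Rmin d1 d2). split; [now apply Rmin_pos|]. intros y Hy Hxy.
  assert (Hm : 0 < Rmin d1 d2) by now apply Rmin_pos.
  pose proof (Rmin_l d1 d2). pose proof (Rmin_r d1 d2).
  apply Hd; [apply H1|apply H2]; try assumption; nra.
Qed.

Lemma continuous_on_comp n S (phi : R -> R) f :
  (forall x, S x -> continuity_pt phi (f x)) ->
  continuous_on n S f -> continuous_on n S (fun x => phi (f x)).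
Proof.
  intros Hphi Hf.
  apply (continuous_on_comp2 n S (fun a _ => phi a) f f); [|assumption|assumption].
  intros x Hx. apply continuity_1d_2d_pt_comp with (g := fun a _ => a).
  - now apply Hphi.
  - apply continuity_2d_pt_id1.
Qed.

Lemma continuous_on_plus n S f g :
  continuous_on n S f -> continuous_on n S g -> continuous_on n S (fun x => f x + g x).
Proof.
  apply (continuous_on_comp2 n S Rplus). intros.
  apply continuity_2d_pt_plus; [apply continuity_2d_pt_id1|apply continuity_2d_pt_id2].
Qed.

Lemma continuous_on_mult n S f g :
  continuous_on n S f -> continuous_on n S g -> continuous_on n S (fun x => f x * g x).
Proof.
  apply (continuous_on_comp2 n S Rmult). intros.
  apply continuity_2d_pt_mult; [apply continuity_2d_pt_id1|apply continuity_2d_pt_id2].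
Qed.

Lemma continuous_on_opp n S f : continuous_on n S f -> continuous_on n S (fun x => - f x).
Proof.
  apply continuous_on_comp. intros. apply continuity_pt_opp, continuity_pt_id.
Qed.

Lemma continuous_on_div n S f g : (forall x, S x -> g x <> 0) ->
  continuous_on n S f -> continuous_on n S g -> continuous_on n S (fun x => f x / g x).
Proof.
  intros Hg Hf Hc. apply continuous_on_mult; [assumption|].
  apply (continuous_on_comp n S Rinv g); [|assumption].
  intros x Hx. apply continuity_pt_inv; [apply continuity_pt_id|now apply Hg].
Qed.

Lemma continuous_on_rsum n S m (f : nat -> point -> R) :
  (forall i, (i < m)%nat -> continuous_on n S (f i)) ->
  continuous_on n S (fun x => rsum m (fun i => f i x)).
Proof.
  induction m as [|m IH]; intros H; simpl; [apply continuous_on_const|].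
  apply continuous_on_plus; [apply IH; intros|]; apply H; lia.
Qed.

Lemma continuous_on_subset n (S T : point -> Prop) f :
  (forall x, S x -> T x) -> continuous_on n T f -> continuous_on n S f.
Proof.
  intros HST Hf x Hx eps He. destruct (Hf x (HST x Hx) eps He) as [d [Hd H]].
  exists d. split; [assumption|]. intros y Hy. apply H. now apply HST.
Qed.

(** * Compactness *)

Definition closed_in_Rn n (D : point -> Prop) :=
  forall x, inRn n x -> ~ D x -> exists eps, 0 < eps /\
    forall y, inRn n y -> dist2 n x y < eps^2 -> ~ D y.

(* Heine-Borel, with "covered by finitely many sets of the cover" abstracted to membership in an ideal [Q]. *)
Lemma interval_in_ideal (Q : (R -> Prop) -> Prop) (a b : R) :
  (forall A B : R -> Prop, (forall t, A t -> B t) -> Q B -> Q A) ->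
  (forall A B : R -> Prop, Q A -> Q B -> Q (fun t => A t \/ B t)) ->
  a <= b ->
  (forall t, a <= t <= b -> exists d, 0 < d /\ Q (fun s => Rabs (s - t) < d)) ->
  Q (fun s => a <= s <= b).
Proof.
  intros Hmono Hunion Hab Hloc.
  pose (E := fun s => a <= s <= b /\ Q (fun r => a <= r <= s)).
  destruct (completeness E) as [m [Hub Hlub]].
  - exists b. intros s [Hs _]. lra.
  - exists a. split; [lra|]. destruct (Hloc a) as [d [Hd HQ]]; [lra|].
    apply Hmono with (2 := HQ). intros t Ht. replace (t - a) with 0 by lra.
    rewrite Rabs_R0. lra.
  - assert (Ham : a <= m).
    { apply Hub. split; [lra|]. destruct (Hloc a) as [d [Hd HQ]]; [lra|].
      apply Hmono with (2 := HQ). intros t Ht. replace (t - a) with 0 by lra.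
      rewrite Rabs_R0. lra. }
    assert (Hmb : m <= b) by (apply Hlub; intros s [Hs _]; lra).
    destruct (Hloc m) as [d [Hd HQ]]; [lra|].
    assert (Hs : exists s, E s /\ m - d < s).
    { apply NNPP. intros Hn. assert (m <= m - d); [|lra].
      apply Hlub. intros s Hs. apply Rnot_lt_le. intros Hlt. apply Hn. now exists s. }
    destruct Hs as [s [[Hs1 Hs2] Hs3]].
    (* Since [s > m - d], the segment up to [s] and the neighbourhood of [m] together reach
       [m + d / 2], beyond the supremum [m] unless [b] comes first. *)
    assert (HQ' : Q (fun r => a <= r <= Rmin b (m + d / 2))).
    { apply Hmono with (2 := Hunion _ _ Hs2 HQ). intros t [Ht1 Ht2].
      pose proof (Rmin_r b (m + d / 2)).
      destruct (Rle_dec t s); [left; lra|right]. apply Rabs_def1; lra. }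
    destruct (Rle_dec b (m + d / 2)) as [Hle|Hgt].
    + rewrite Rmin_left in HQ' by assumption. exact HQ'.
    + rewrite Rmin_right in HQ' by lra. assert (m + d / 2 <= m); [|lra].
      apply Hub. split; [lra|assumption].
Qed.

(** A tube-lemma induction: the first [m] coordinates range over [[-1, 1]], the others over a small
    box around [x]. Each step frees one more coordinate by the interval lemma. *)
Lemma cube_in_ideal n (Q : (point -> Prop) -> Prop) :
  (forall A B : point -> Prop, (forall x, A x -> B x) -> Q B -> Q A) ->
  (forall A B : point -> Prop, Q A -> Q B -> Q (fun x => A x \/ B x)) ->
  (forall x, inRn n x -> exists d, 0 < d /\
     Q (fun y => inRn n y /\ forall i, (i < n)%nat -> Rabs (y i - x i) < d)) ->
  Q (fun y => inRn n y /\ forall i, (i < n)%nat -> -1 <= y i <= 1).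
Proof.
  intros Hmono Hunion Hloc.
  assert (H : forall m, (m <= n)%nat -> forall x, inRn n x -> exists d, 0 < d /\
     Q (fun y => inRn n y /\ (forall i, (i < m)%nat -> -1 <= y i <= 1) /\
                 forall i, (m <= i < n)%nat -> Rabs (y i - x i) < d)).
  { induction m as [|m IH]; intros Hm x Hx.
    - destruct (Hloc x Hx) as [d [Hd HQ]]. exists d. split; [assumption|].
      apply Hmono with (2 := HQ). intros y [Hy1 [_ Hy2]]. split; [assumption|].
      intros i Hi. apply Hy2. lia.
    (* [Q1] is the ideal induced on coordinate [m]: sets [A] over which some thin enough tube lies
       in [Q]. A union keeps the thinner of two tubes. *)
    - pose (Q1 := fun A : R -> Prop => exists d, 0 < d /\
        Q (fun y => A (y m) /\ inRn n y /\ (forall i, (i < m)%nat -> -1 <= y i <= 1) /\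
                 forall i, (m < i < n)%nat -> Rabs (y i - x i) < d)).
      destruct (interval_in_ideal Q1 (-1) 1) as [d [Hd HQ]].
      + intros A B HAB [d [Hd HQ]]. exists d. split; [assumption|].
        apply Hmono with (2 := HQ). intros y [Hy1 Hy2]. split; [now apply HAB|assumption].
      + intros A B [d [Hd HQ]] [d' [Hd' HQ']].
        exists (Rmin d d'). split; [now apply Rmin_pos|].
        apply Hmono with (2 := Hunion _ _ HQ HQ').
        intros y [[HA|HB] [Hy1 [Hy2 Hy3]]]; [left|right]; repeat split; try assumption;
          try (apply Hy2; assumption);
          intros i Hi; (eapply Rlt_le_trans; [now apply Hy3|]);
          [apply Rmin_l|apply Rmin_r].
      + lra.
      + intros t Ht. destruct (IH ltac:(lia) (upd x m t)) as [d [Hd HQ]].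
        { apply upd_inRn; [lia|assumption]. }
        exists d. split; [assumption|]. exists d. split; [assumption|].
        apply Hmono with (2 := HQ). intros y [Hy1 [Hy2 [Hy3 Hy4]]].
        repeat split; try assumption; try (apply Hy3; assumption).
        intros i Hi. unfold upd. destruct (Nat.eqb_spec i m) as [->|]; [assumption|].
        apply Hy4. lia.
      + exists d. split; [assumption|]. apply Hmono with (2 := HQ).
        intros y [Hy1 [Hy2 Hy3]]. split; [apply Hy2; lia|]. split; [assumption|]. split.
        * intros i Hi. apply Hy2. lia.
        * intros i Hi. apply Hy3. lia. }
  destruct (H n (le_n n) (fun _ => 0)) as [d [Hd HQ]]; [now intros i _|].
  apply Hmono with (2 := HQ). intros y [Hy1 Hy2]. repeat split; try assumption;
    try (apply Hy2; assumption). intros i Hi. lia.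
Qed.

(** The sets on which [f] is dominated by a single value [f z] with [z] in [D] form an ideal.
    Without a maximum every point has a neighbourhood in this ideal, so the cube belongs to it, and
    its [z] is a maximum after all. *)
Lemma compact_max n (D : point -> Prop) (f : point -> R) :
  (exists x, D x) ->
  (forall x, D x -> inRn n x /\ norm2 n x <= 1) ->
  closed_in_Rn n D -> continuous_on n D f ->
  exists z, D z /\ forall y, D y -> f y <= f z.
Proof.
  intros [x0 Hx0] Hbd Hcl Hf. apply NNPP. intros Hno.
  assert (Hno' : forall z, D z -> exists y, D y /\ f z < f y).
  { intros z Hz. apply NNPP. intros H. apply Hno. exists z. split; [assumption|].
    intros y Hy. apply Rnot_lt_le. intros Hlt. apply H. now exists y. }
  pose (Q := fun A : point -> Prop =>
               exists z, D z /\ forall y, A y -> D y -> f y <= f z).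
  destruct (cube_in_ideal n Q) as [z [Hz HQ]].
  - intros A B HAB [z [Hz H]]. exists z. split; [assumption|]. intros y Hy.
    apply H. now apply HAB.
  - intros A B [z [Hz H]] [z' [Hz' H']]. destruct (Rle_dec (f z) (f z')).
    + exists z'. split; [assumption|]. intros y [Hy|Hy] HD; [|now apply H'].
      specialize (H y Hy HD). lra.
    + exists z. split; [assumption|]. intros y [Hy|Hy] HD; [now apply H|].
      specialize (H' y Hy HD). lra.
  - assert (Hball : forall x e, 0 < e -> exists d, 0 < d /\ forall y,
       (forall i, (i < n)%nat -> Rabs (y i - x i) < d) -> dist2 n x y < e^2).
    { intros x e He. pose proof (pos_INR n) as Hn.
      (* A box of half-width [d = e / (n + 1)] has squared radius at most
         [n d^2 < (n + 1)^2 d^2 = e^2]; the [+ 1] also covers [n = 0]. *)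
      assert (He' : 0 < e / (INR n + 1)) by (apply Rdiv_lt_0_compat; lra).
      exists (e / (INR n + 1)). split; [assumption|].
      intros y Hy. apply Rle_lt_trans with (1 := dist2_coords n x y _ Hy).
      replace (e^2) with ((INR n + 1)^2 * (e / (INR n + 1))^2) by (field; lra).
      apply Rmult_lt_compat_r; nra. }
    intros x Hx. destruct (classic (D x)) as [HD|HnD].
    + destruct (Hno' x HD) as [z [Hz Hlt]].
      destruct (Hf x HD (f z - f x)) as [e [He H]]; [lra|].
      destruct (Hball x e He) as [d [Hd Hd']]. exists d. split; [assumption|].
      exists z. split; [assumption|]. intros y [_ Hy] HDy.
      specialize (H y HDy (Hd' y Hy)). apply Rabs_def2 in H. lra.
    + destruct (Hcl x Hx HnD) as [e [He H]].
      destruct (Hball x e He) as [d [Hd Hd']]. exists d. split; [assumption|].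
      (* The neighbourhood misses [D], so any point of [D] dominates vacuously. *)
      exists x0. split; [assumption|]. intros y [Hy1 Hy2] HDy.
      exfalso. exact (H y Hy1 (Hd' y Hy2) HDy).
  - apply Hno. exists z. split; [assumption|]. intros y Hy. apply HQ; [|assumption].
    destruct (Hbd y Hy) as [Hy1 Hy2]. split; [assumption|]. intros i Hi.
    assert ((y i)^2 <= norm2 n y).
    { apply (rsum_term_le n (fun j => (y j)^2)); [intros; apply pow2_ge_0|assumption]. }
    nra.
Qed.

Lemma closed_closureE n O : closed_in_Rn n (closureE n O).
Proof.
  intros x Hin Hx. apply NNPP. intros Hno. apply Hx. split; [assumption|]. intros eps He.
  (* Half the radius matches the factor 2 in [dist2_triangle]:
     [2 ((eps/2)^2 + (eps/2)^2) = eps^2]. *)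
  apply NNPP. intros Hy. apply Hno. exists (eps / 2). split; [lra|].
  intros y Hyin Hxy [_ HOy]. destruct (HOy (eps / 2)) as [z [Hz Hyz]]; [lra|].
  apply Hy. exists z. split; [assumption|].
  apply Rlt_le_trans with (2 * ((eps / 2)^2 + (eps / 2)^2)); [|nra].
  apply dist2_triangle with y; lra || assumption.
Qed.

Lemma closed_ge0 n f : continuous_on n (inRn n) f -> closed_in_Rn n (fun x => 0 <= f x).
Proof.
  intros Hf x Hx Hneg. destruct (Hf x Hx (- f x)) as [d [Hd H]]; [lra|].
  exists d. split; [assumption|]. intros y Hy Hxy.
  specialize (H y Hy Hxy). apply Rabs_def2 in H. lra.
Qed.

Lemma closed_inter n (A B : point -> Prop) :
  closed_in_Rn n A -> closed_in_Rn n B -> closed_in_Rn n (fun x => A x /\ B x).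
Proof.
  intros HA HB x Hx HnAB. destruct (classic (A x)) as [HAx|HAx].
  - destruct (HB x Hx) as [d [Hd H]]; [tauto|].
    exists d. split; [assumption|]. intros y Hy Hxy [_ HBy]. exact (H y Hy Hxy HBy).
  - destruct (HA x Hx HAx) as [d [Hd H]].
    exists d. split; [assumption|]. intros y Hy Hxy [HAy _]. exact (H y Hy Hxy HAy).
Qed.

(** * The second derivative test *)

(** If [c > 0], then [G1] is positive just to the right of its zero [t0], and the mean value theorem
    makes [G] exceed [G t0] there. *)
Lemma local_max_derivatives (G G1 : R -> R) t0 c d : 0 < d ->
  (forall t, Rabs (t - t0) < d -> derivable_pt_lim G t (G1 t) /\ G t <= G t0) ->
  derivable_pt_lim G1 t0 c -> G1 t0 = 0 /\ c <= 0.
Proof.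
  intros Hd HG HG1.
  assert (Hz : G1 t0 = 0).
  { destruct (HG t0) as [H0 _]; [rewrite Rminus_diag, Rabs_R0; assumption|].
    apply Rle_antisym; apply Rnot_lt_le; intros Hlt.
    (* With tolerance [G1 t0] the difference quotient stays positive, so a small step to the right
       increases [G]; the other case steps to the left. *)
    - destruct (H0 (G1 t0) Hlt) as [e He].
      pose proof (cond_pos e) as Hep. pose proof (Rmin_l d e). pose proof (Rmin_r d e).
      assert (Hm : 0 < Rmin d e) by now apply Rmin_pos.
      set (h := Rmin d e / 2) in *. assert (0 < h) by (unfold h; lra).
      specialize (He h ltac:(lra)). rewrite (Rabs_right h) in He by lra.
      specialize (He ltac:(unfold h; lra)). apply Rabs_def2 in He.
      destruct (HG (t0 + h)) as [_ Hle].
      { replace (t0 + h - t0) with h by ring. rewrite Rabs_right; unfold h; lra. }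
      assert (0 < (G (t0 + h) - G t0) / h) by lra.
      assert (0 < (G (t0 + h) - G t0) / h * h) by nra.
      replace ((G (t0 + h) - G t0) / h * h) with (G (t0 + h) - G t0) in * by (field; lra). lra.
    - destruct (H0 (- G1 t0)) as [e He]; [lra|].
      pose proof (cond_pos e) as Hep. pose proof (Rmin_l d e). pose proof (Rmin_r d e).
      assert (Hm : 0 < Rmin d e) by now apply Rmin_pos.
      set (h := - (Rmin d e / 2)) in *. assert (h < 0) by (unfold h; lra).
      specialize (He h ltac:(lra)). rewrite (Rabs_left h) in He by lra.
      specialize (He ltac:(unfold h; lra)). apply Rabs_def2 in He.
      destruct (HG (t0 + h)) as [_ Hle].
      { replace (t0 + h - t0) with h by ring. rewrite Rabs_left; unfold h; lra. }
      assert ((G (t0 + h) - G t0) / h < 0) by lra.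
      assert (0 < (G (t0 + h) - G t0) / h * h) by nra.
      replace ((G (t0 + h) - G t0) / h * h) with (G (t0 + h) - G t0) in * by (field; lra). lra. }
  split; [assumption|]. apply Rnot_lt_le. intros Hc.
  destruct (HG1 c Hc) as [e He].
  pose proof (cond_pos e) as Hep. pose proof (Rmin_l d e). pose proof (Rmin_r d e).
  assert (Hm : 0 < Rmin d e) by now apply Rmin_pos.
  assert (Hpos : forall h, 0 < h < Rmin d e -> 0 < G1 (t0 + h)).
  { intros h Hh. specialize (He h ltac:(lra)). rewrite (Rabs_right h) in He by lra.
    specialize (He ltac:(lra)). apply Rabs_def2 in He. rewrite Hz in He.
    assert (0 < (G1 (t0 + h) - 0) / h) by lra.
    assert (0 < (G1 (t0 + h) - 0) / h * h) by nra.
    replace ((G1 (t0 + h) - 0) / h * h) with (G1 (t0 + h)) in * by (field; lra). lra. }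
  set (h := Rmin d e / 2) in *.
  destruct (MVT_cor2 G G1 t0 (t0 + h)) as [s [Hs1 Hs2]].
  - unfold h; lra.
  - intros s Hs. apply HG. rewrite Rabs_right; unfold h in *; lra.
  - assert (0 < G1 s).
    { replace s with (t0 + (s - t0)) by ring. apply Hpos. unfold h in *; lra. }
    destruct (HG (t0 + h)) as [_ Hle].
    { replace (t0 + h - t0) with h by ring. rewrite Rabs_right; unfold h; lra. }
    assert (0 < h) by (unfold h; lra). nra.
Qed.

(** * The radial profile of the barrier *)

(** [exp (- b * ln s)] is [s^(-b)] with a real exponent, for [s > 0]. The factor [2 - k / s] makes
    the supersolution strict, and lies between 1 and 2 for [s >= k]. *)
Definition profile (b k s : R) : R := exp (- b * ln s) * (2 - k / s).
Definition profile' (b k s : R) : R :=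
  exp (- b * ln s) * (- 2 * b / s + (b + 1) * k / s^2).
Definition profile'' (b k s : R) : R :=
  exp (- b * ln s) * (2 * b * (b + 1) / s^2 - (b + 1) * (b + 2) * k / s^3).

Lemma profile_derivative b k s : 0 < s ->
  derivable_pt_lim (profile b k) s (profile' b k s).
Proof.
  intros Hs. apply is_derive_Reals. unfold profile, profile'.
  auto_derive; [repeat split; lra|]. field. lra.
Qed.

Lemma profile'_derivative b k s : 0 < s ->
  derivable_pt_lim (profile' b k) s (profile'' b k s).
Proof.
  intros Hs. apply is_derive_Reals. unfold profile', profile''.
  auto_derive; [repeat split; try lra; nra|]. field. lra.
Qed.

(* The constant terms cancel because [-b] is a double root of the indicial equation; what is left is a multiple of [-z + 2b(b+1)z^2 - (b+1)(b+2)z^3] with [z = k/s]. *)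
Lemma profile_supersolution b k s : 0 < b -> 0 < k -> (2 * b * (b + 1) + 1) * k <= s ->
  profile'' b k s * (s^2 + k^2) + (2 * b + 1) * s * profile' b k s + b^2 * profile b k s < 0.
Proof.
  intros Hb Hk Hs.
  assert (Hs0 : 0 < s) by nra.
  assert (Hz : 0 < k / s) by now apply Rdiv_lt_0_compat.
  replace (_ + _ + _) with
    (- (exp (- b * ln s) * (k / s *
       (1 - 2 * b * (b + 1) * (k / s) + (b + 1) * (b + 2) * (k / s)^2)))).
  2:{ unfold profile, profile', profile''. field. lra. }
  (* The threshold on [s] bounds the negative term by [1 - k / s], leaving the bracket positive. *)
  assert ((2 * b * (b + 1) + 1) * (k / s) <= 1).
  { apply Rmult_le_reg_r with s; [assumption|].
    replace ((2 * b * (b + 1) + 1) * (k / s) * s) with ((2 * b * (b + 1) + 1) * k) by (field; lra).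
    lra. }
  pose proof (exp_pos (- b * ln s)).
  assert (0 < (b + 1) * (b + 2) * (k / s)^2) by (apply Rmult_lt_0_compat; nra).
  assert (0 < exp (- b * ln s) * (k / s *
       (1 - 2 * b * (b + 1) * (k / s) + (b + 1) * (b + 2) * (k / s)^2))); [|lra].
  apply Rmult_lt_0_compat; [assumption|]. apply Rmult_lt_0_compat; [assumption|lra].
Qed.

Lemma profile_bounds b k s : 0 < k -> k <= s ->
  exp (- b * ln s) <= profile b k s <= 2 * exp (- b * ln s).
Proof.
  intros Hk Hs. pose proof (exp_pos (- b * ln s)). unfold profile.
  assert (0 < k / s) by (apply Rdiv_lt_0_compat; lra).
  assert (k / s <= 1).
  { apply Rmult_le_reg_r with s; [lra|]. replace (k / s * s) with k by (field; lra). lra. }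
  nra.
Qed.

(** * The barrier on the ball *)

Definition dot n (p x : point) : R := rsum n (fun i => p i * x i).

(* [sinh] of the signed distance to a totally geodesic hyperplane around [p], multiplied by [sqrt (be^2 - 1)]; positive on the side away from [p]. *)
Definition height n be (p x : point) : R :=
  (1 + norm2 n x - 2 * be * dot n p x) / (1 - norm2 n x).
(** The partials are written through [height] itself, which keeps the Laplacian and gradient
    identities short. [height_dd] is the pure second partial, all that the Laplacian involves. *)
Definition height_d n be (p : point) i (x : point) : R :=
  2 * (x i * (1 + height n be p x) - be * p i) / (1 - norm2 n x).
Definition height_dd n be (p : point) i (x : point) : R :=
  (2 * (1 + height n be p x) + 4 * x i * height_d n be p i x) / (1 - norm2 n x).

Lemma norm2_upd n x i t : (i < n)%nat -> norm2 n (upd x i t) = norm2 n x - (x i)^2 + t^2.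
Proof. apply (rsum_update n (fun _ s => s^2)). Qed.

Lemma dot_upd n p x i t : (i < n)%nat -> dot n p (upd x i t) = dot n p x - p i * x i + p i * t.
Proof. apply (rsum_update n (fun j s => p j * s)). Qed.

Lemma height_partial n be p i x : (i < n)%nat -> norm2 n x < 1 ->
  derivable_pt_lim (fun t => height n be p (upd x i t)) (x i) (height_d n be p i x).
Proof.
  intros Hi Hx. apply is_derive_Reals.
  apply is_derive_ext with (fun t => (1 + (norm2 n x - (x i)^2 + t^2)
     - 2 * be * (dot n p x - p i * x i + p i * t)) / (1 - (norm2 n x - (x i)^2 + t^2))).
  { intros t. unfold height. now rewrite norm2_upd, dot_upd. }
  unfold height_d, height. auto_derive; [|field]; repeat split; nra.
Qed.

Lemma height_d_partial n be p i x : (i < n)%nat -> norm2 n x < 1 ->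
  derivable_pt_lim (fun t => height_d n be p i (upd x i t)) (x i) (height_dd n be p i x).
Proof.
  intros Hi Hx. apply is_derive_Reals.
  pose proof (proj2 (is_derive_Reals _ _ _) (height_partial n be p i x Hi Hx)) as Hd.
  (* [height] along the coordinate line is made opaque, so that [auto_derive] leaves its derivative
     symbolic and the value from [height_partial] can be inserted. *)
  remember (fun t => height n be p (upd x i t)) as H eqn:EH.
  apply is_derive_ext with (fun t => 2 * (t * (1 + H t) - be * p i)
     / (1 - (norm2 n x - (x i)^2 + t^2))).
  { intros t. subst H. unfold height_d. now rewrite norm2_upd, upd_same. }
  assert (Hx0 : H (x i) = height n be p x) by now rewrite EH, upd_id.
  clear EH. auto_derive; [repeat split; [now exists (height_d n be p i x)|nra]|].
  change (Derive (fun t => H t) (x i)) with (Derive H (x i)).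
  rewrite (is_derive_unique _ _ _ Hd), Hx0. unfold height_dd, height_d. field. nra.
Qed.

(** In hyperboloid coordinates [X0 = (1 + |x|^2) / (1 - |x|^2)] and [X = 2 x / (1 - |x|^2)],
    [height] is the linear function [X0 - be p.X]. The Hessian of such a function is the function
    times the metric, and the trace gives [n]. *)
Lemma hyp_laplacian_height n be p x : norm2 n x < 1 ->
  hyp_laplacian n (height_d n be p) (fun i _ => height_dd n be p i) x = INR n * height n be p x.
Proof.
  intros Hx. unfold hyp_laplacian.
  assert (Hg : rsum n (fun i => x i * height_d n be p i x) =
    2 * (norm2 n x * (1 + height n be p x) - be * dot n p x) / (1 - norm2 n x)).
  { unfold height_d, norm2 at 3, dot.
    rewrite (rsum_ext n _ (fun i => 2 * (1 + height n be p x) / (1 - norm2 n x) * (x i)^2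
       + (- 2 * be / (1 - norm2 n x)) * (p i * x i))).
    - rewrite rsum_plus, !rsum_scal. fold (norm2 n x). field. lra.
    - intros i _. field. lra. }
  rewrite (rsum_ext n (fun i => height_dd n be p i x)
    (fun i => 2 * (1 + height n be p x) / (1 - norm2 n x)
              + 4 / (1 - norm2 n x) * (x i * height_d n be p i x))).
  2:{ intros i _. unfold height_dd. field. lra. }
  rewrite rsum_plus, rsum_scal, rsum_const, Hg. unfold height. field. lra.
Qed.

(** The constant [be^2 - 1] is the Lorentzian square of the covector [(1, - be p)] that defines
    [height]. *)
Lemma hyp_gradient_height n be p x : norm2 n x < 1 -> norm2 n p = 1 ->
  ((1 - norm2 n x) / 2)^2 * rsum n (fun i => (height_d n be p i x)^2)
  = (height n be p x)^2 + (be^2 - 1).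
Proof.
  intros Hx Hp.
  rewrite (rsum_ext n _ (fun i => (2 / (1 - norm2 n x))^2 *
     ((1 + height n be p x)^2 * (x i)^2 + (- 2 * be * (1 + height n be p x)) * (p i * x i)
      + be^2 * (p i)^2))).
  2:{ intros i _. unfold height_d. field. lra. }
  rewrite rsum_scal, !rsum_plus, !rsum_scal.
  fold (norm2 n x) (norm2 n p) (dot n p x). rewrite Hp. unfold height. field. lra.
Qed.

Lemma norm2_continuous n S : continuous_on n S (norm2 n).
Proof.
  apply (continuous_on_rsum n S n (fun i x => (x i)^2)). intros i Hi.
  apply (continuous_on_comp n S (fun s => s^2)); [|now apply continuous_on_coord].
  intros x _. apply derivable_continuous_pt, derivable_pt_pow.
Qed.

Lemma dot_continuous n S p : continuous_on n S (dot n p).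
Proof.
  apply (continuous_on_rsum n S n (fun i x => p i * x i)). intros i Hi.
  apply continuous_on_mult; [apply continuous_on_const|now apply continuous_on_coord].
Qed.

Lemma height_continuous n be p : continuous_on n (Hn n) (height n be p).
Proof.
  apply continuous_on_div; [intros x [_ Hx]; lra|..];
    repeat apply continuous_on_plus; try apply continuous_on_opp;
    try apply continuous_on_mult; try apply continuous_on_const;
    try apply norm2_continuous; apply dot_continuous.
Qed.

Lemma barrier_partial n be p b k i x : (i < n)%nat -> norm2 n x < 1 -> 0 < height n be p x ->
  derivable_pt_lim (fun t => profile b k (height n be p (upd x i t))) (x i)
    (profile' b k (height n be p x) * height_d n be p i x).
Proof.
  intros Hi Hx Hh.
  apply (derivable_pt_lim_comp (fun t => height n be p (upd x i t)) (profile b k)).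
  - now apply height_partial.
  - rewrite upd_id. now apply profile_derivative.
Qed.

Lemma barrier_partial2 n be p b k i x : (i < n)%nat -> norm2 n x < 1 -> 0 < height n be p x ->
  derivable_pt_lim
    (fun t => profile' b k (height n be p (upd x i t)) * height_d n be p i (upd x i t)) (x i)
    (profile'' b k (height n be p x) * (height_d n be p i x)^2
     + profile' b k (height n be p x) * height_dd n be p i x).
Proof.
  intros Hi Hx Hh.
  pose proof (derivable_pt_lim_comp (fun t => height n be p (upd x i t)) (profile' b k) (x i)
    (height_d n be p i x) (profile'' b k (height n be p x))) as H1.
  cbv beta in H1. rewrite upd_id in H1.
  specialize (H1 (height_partial n be p i x Hi Hx) (profile'_derivative b k _ Hh)).
  pose proof (derivable_pt_lim_mult _ _ _ _ _ H1 (height_d_partial n be p i x Hi Hx)) as H.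
  unfold comp, mult_fct in H. rewrite upd_id in H.
  replace (_ + _) with (profile'' b k (height n be p x) * height_d n be p i x *
    height_d n be p i x + profile' b k (height n be p x) * height_dd n be p i x) by ring.
  exact H.
Qed.

(** Write [F] for the barrier. Where [v F] touches [u] from above, the second derivative test on
    coordinate lines gives [Delta u <= v Delta F < - lam v F = - lam u], against the equation.
    Strictness of the height threshold at [x] keeps the comparison valid at nearby points. *)
Lemma no_interior_touching n O u g h lam b k be p x v :
  b = (INR n - 1) / 2 -> 0 < b -> lam <= b^2 -> 0 < k -> be^2 = 1 + k^2 -> norm2 n p = 1 ->
  open_in_Rn n O -> (forall y, O y -> Hn n y) -> C2_on n O u g h ->
  O x -> - hyp_laplacian n g h x = lam * u x ->
  0 < v -> (2 * b * (b + 1) + 1) * k < height n be p x ->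
  (forall y, O y -> (2 * b * (b + 1) + 1) * k < height n be p y ->
     u y <= v * profile b k (height n be p y)) ->
  u x = v * profile b k (height n be p x) -> False.
Proof.
  intros Hbn Hb Hlam Hk Hbe Hp HopenO HOH [_ HC2] HOx Heq Hv Hx Hle Htouch.
  set (K := (2 * b * (b + 1) + 1) * k) in *.
  assert (HkK : k <= K) by (unfold K; nra).
  destruct (HOH x HOx) as [Hxin Hxn].
  destruct (HopenO x HOx) as [e1 [He1 HO1]].
  (* One radius serves all coordinate directions, by openness of [O] and continuity of [height]. *)
  assert (Hnear : exists d, 0 < d /\ forall i t, (i < n)%nat -> Rabs (t - x i) < d ->
    O (upd x i t) /\ K < height n be p (upd x i t)).
  { destruct (height_continuous n be p x (conj Hxin Hxn) (height n be p x - K)) as [e2 [He2 Hh2]];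
      [lra|].
    exists (Rmin e1 e2). split; [now apply Rmin_pos|]. intros i t Hi Ht.
    pose proof (Rmin_l e1 e2). pose proof (Rmin_r e1 e2).
    apply Rabs_def2 in Ht.
    assert (HOu : O (upd x i t)).
    { apply HO1; [now apply upd_inRn|]. rewrite dist2_upd by assumption. nra. }
    split; [assumption|].
    specialize (Hh2 (upd x i t) (HOH _ HOu)). rewrite dist2_upd in Hh2 by assumption.
    specialize (Hh2 ltac:(nra)). apply Rabs_def2 in Hh2. lra. }
  destruct Hnear as [d [Hd Hnear]].
  assert (Hder : forall i, (i < n)%nat ->
    g i x = v * (profile' b k (height n be p x) * height_d n be p i x) /\
    h i i x <= v * (profile'' b k (height n be p x) * (height_d n be p i x)^2
                   + profile' b k (height n be p x) * height_dd n be p i x)).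
  { intros i Hi. destruct (HC2 i Hi) as [Hg [_ Hh]]. destruct (Hh i Hi) as [Hh' _].
    destruct (local_max_derivatives
      (fun t => u (upd x i t) - v * profile b k (height n be p (upd x i t)))
      (fun t => g i (upd x i t) -
         v * (profile' b k (height n be p (upd x i t)) * height_d n be p i (upd x i t)))
      (x i)
      (h i i x - v * (profile'' b k (height n be p x) * (height_d n be p i x)^2
                   + profile' b k (height n be p x) * height_dd n be p i x)) d Hd) as [H1 H2].
    - intros t Ht. destruct (Hnear i t Hi Ht) as [HOt HKt]. split.
      + pose proof (Hg _ HOt) as H1.
        pose proof (barrier_partial n be p b k i (upd x i t) Hi
          (proj2 (HOH _ HOt)) ltac:(lra)) as H2.
        rewrite upd_same in H1, H2.
        apply derivable_pt_lim_minus.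
        * apply derivable_pt_lim_ext with (2 := H1). intros s. now rewrite upd_upd.
        * apply derivable_pt_lim_scal.
          apply derivable_pt_lim_ext with (2 := H2). intros s. now rewrite upd_upd.
      + rewrite upd_id, Htouch. specialize (Hle _ HOt HKt). lra.
    - apply derivable_pt_lim_minus; [now apply Hh'|].
      apply derivable_pt_lim_scal. apply barrier_partial2; lra || assumption.
    - rewrite upd_id in H1. split; lra. }
  pose proof (profile_supersolution b k (height n be p x) Hb Hk ltac:(unfold K in Hx; lra)) as Hsup.
  pose proof (hyp_laplacian_height n be p x Hxn) as HL.
  pose proof (hyp_gradient_height n be p x Hxn Hp) as HG.
  replace (be^2 - 1) with (k^2) in HG by lra.
  assert (Hlap : hyp_laplacian n g h x <=
    v * (profile'' b k (height n be p x) * ((height n be p x)^2 + k^2)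
         + profile' b k (height n be p x) * (INR n * height n be p x))).
  { rewrite <- HL, <- HG. unfold hyp_laplacian.
    (* The coefficients [x i] have no fixed sign, so the first-order terms need the equality of
       gradients; for the second-order terms an inequality suffices. *)
    rewrite (rsum_ext n (fun i => x i * g i x)
      (fun i => v * profile' b k (height n be p x) * (x i * height_d n be p i x))).
    2:{ intros i Hi. rewrite (proj1 (Hder i Hi)). ring. }
    rewrite rsum_scal.
    assert (Hs : rsum n (fun i => h i i x) <=
      v * profile'' b k (height n be p x) * rsum n (fun i => (height_d n be p i x)^2)
      + v * profile' b k (height n be p x) * rsum n (fun i => height_dd n be p i x)).
    { rewrite <- !rsum_scal, <- rsum_plus. apply rsum_le. intros i Hi.
      destruct (Hder i Hi) as [_ H]. cbv beta. lra. }
    pose proof (pow2_ge_0 ((1 - norm2 n x) / 2)).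
    eapply Rle_trans.
    { apply Rmult_le_compat_l; [assumption|]. apply Rplus_le_compat_r. exact Hs. }
    right. ring. }
  destruct (profile_bounds b k (height n be p x) Hk ltac:(lra)) as [Hpos _].
  pose proof (exp_pos (- b * ln (height n be p x))).
  replace (2 * b + 1) with (INR n) in Hsup by lra.
  (* Positivity of the barrier passes from the critical value [b^2] in [Hsup] to any smaller
     [lam]. *)
  assert (0 <= (b^2 - lam) * profile b k (height n be p x)) by (apply Rmult_le_pos; lra).
  nra.
Qed.

(** * The maximum principle *)

(** Expanding [|x - c p|^2 >= 0] with [c = (1 + |x|^2) / 2] gives strictness because [|x|^2 < c^2];
    the choice [c = 1] would give only the weak inequality. *)
Lemma two_dot_lt n p x : norm2 n p = 1 -> norm2 n x < 1 -> 2 * dot n p x < 1 + norm2 n x.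
Proof.
  intros Hp Hx. set (c := (1 + norm2 n x) / 2).
  assert (Hr : 0 <= norm2 n x) by (apply rsum_ge0; intros; apply pow2_ge_0).
  assert (H : 0 <= rsum n (fun i => (x i - c * p i)^2))
    by (apply rsum_ge0; intros; apply pow2_ge_0).
  rewrite (rsum_ext n _ (fun i => (x i)^2 + (- 2 * c) * (p i * x i) + c^2 * (p i)^2)) in H
    by (intros; ring).
  rewrite !rsum_plus, !rsum_scal in H.
  fold (norm2 n x) (norm2 n p) (dot n p x) in H. rewrite Hp in H. unfold c in H. nra.
Qed.

Lemma closureE_incl n O x : (forall y, O y -> Hn n y) -> O x -> closureE n O x.
Proof.
  intros HOH Hx. split; [apply HOH, Hx|]. intros eps He. exists x. split; [assumption|].
  unfold dist2. rewrite (rsum_ext n _ (fun _ => 0)) by (intros; ring).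
  rewrite rsum_const, Rmult_0_r. nra.
Qed.

Lemma closureE_norm2 n O x : (forall y, O y -> Hn n y) -> closureE n O x -> norm2 n x <= 1.
Proof.
  intros HOH [Hx HxO]. apply Rnot_lt_le. intros Hlt.
  destruct (norm2_continuous n (inRn n) x Hx (norm2 n x - 1)) as [d [Hd H]]; [lra|].
  destruct (HxO d Hd) as [y [Hy Hxy]]. destruct (HOH y Hy) as [Hy1 Hy2].
  specialize (H y Hy1 Hxy). apply Rabs_def2 in H. lra.
Qed.

(** The profile lies between [s^(-b)] and [2 s^(-b)], so [eta^b <= u0 / (2 M)] is enough. This [eta]
    does not depend on [k], so the hyperplane can be chosen afterwards. *)
Lemma small_barrier b M u0 : 0 < b -> 0 < u0 -> 0 < M ->
  exists eta, 0 < eta <= 1 /\ forall k s t, 0 < k -> k <= s -> s < eta * t ->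
    M * profile b k t < u0 * profile b k s.
Proof.
  intros Hb Hu HM.
  set (e := exp (ln (u0 / (2 * M)) / b)).
  assert (He : 0 < e) by apply exp_pos.
  exists (Rmin e 1). split.
  { split; [apply Rmin_pos; lra|apply Rmin_r]. }
  intros k s t Hk Hks Hst.
  pose proof (Rmin_l e 1). pose proof (Rmin_r e 1).
  assert (Hm : 0 < Rmin e 1) by (apply Rmin_pos; lra).
  assert (Ht : 0 < t) by nra.
  destruct (profile_bounds b k s Hk Hks) as [Hs _].
  destruct (profile_bounds b k t Hk ltac:(nra)) as [_ Ht2].
  assert (Hln : ln s < ln e + ln t).
  { rewrite <- ln_mult by assumption. apply ln_increasing; nra. }
  unfold e in Hln at 1. rewrite ln_exp in Hln.
  assert (Hlt : ln (2 * M / u0) + - b * ln t < - b * ln s).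
  { replace (ln (2 * M / u0)) with (- ln (u0 / (2 * M))).
    2:{ rewrite <- ln_Rinv by (apply Rdiv_lt_0_compat; lra). f_equal. field. lra. }
    apply Rmult_lt_compat_l with (r := b) in Hln; [|assumption].
    replace (b * (ln (u0 / (2 * M)) / b + ln t)) with (ln (u0 / (2 * M)) + b * ln t) in Hln
      by (field; lra). lra. }
  apply exp_increasing in Hlt. rewrite exp_plus, exp_ln in Hlt
    by (apply Rdiv_lt_0_compat; lra).
  apply Rle_lt_trans with (M * (2 * exp (- b * ln t))); [now apply Rmult_le_compat_l; [lra|]|].
  (* [Hlt] now says [(2 M / u0) t^(-b) < s^(-b)]. *)
  apply Rlt_le_trans with (u0 * exp (- b * ln s)); [|now apply Rmult_le_compat_l; [lra|]].
  apply Rmult_lt_compat_l with (r := u0) in Hlt; [|assumption].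
  replace (u0 * (2 * M / u0 * exp (- b * ln t))) with (M * (2 * exp (- b * ln t))) in Hlt
    by (field; lra). exact Hlt.
Qed.

(* As [be] decreases to 1 the hyperplanes shrink to [p]: the height of a fixed point stays away from 0 while [k] tends to 0. *)
Lemma height_lower_bound n p x K eta :
  norm2 n p = 1 -> norm2 n x < 1 -> 0 < K -> 0 < eta ->
  exists k be, 0 < k /\ 1 < be /\ be^2 = 1 + k^2 /\ K * k < eta * height n be p x.
Proof.
  intros Hp Hx HK Heta. pose proof (two_dot_lt n p x Hp Hx) as Hq.
  set (l := 1 + norm2 n x - 2 * dot n p x). assert (Hl : 0 < l) by (unfold l; lra).
  (* Here [l] is the numerator of the height at [be = 1]. As [be <= 1 + k] and [dot n p x < 1], the
     bound [l / 4] keeps the numerator above [l / 2]; the other bound gives [K k <= eta l / 4]. *)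
  set (k := Rmin (l / 4) (eta * l / (4 * K))).
  assert (Hkl : k <= l / 4) by apply Rmin_l.
  assert (Hke : k <= eta * l / (4 * K)) by apply Rmin_r.
  assert (Hk : 0 < k).
  { apply Rmin_pos; [lra|]. apply Rdiv_lt_0_compat; [now apply Rmult_lt_0_compat|lra]. }
  assert (Hsq : sqrt (1 + k^2) ^ 2 = 1 + k^2) by (apply pow2_sqrt; nra).
  pose proof (sqrt_pos (1 + k^2)) as Hs0.
  exists k, (sqrt (1 + k^2)). set (be := sqrt (1 + k^2)) in *.
  assert (Hbe1 : 1 < be) by nra.
  assert (Hbek : be <= 1 + k) by nra.
  repeat split; try assumption.
  assert (Hr : 0 <= norm2 n x) by (apply rsum_ge0; intros; apply pow2_ge_0).
  assert (Hnum : l / 2 <= 1 + norm2 n x - 2 * be * dot n p x) by (unfold l in *; nra).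
  assert (Hh : l / 2 <= height n be p x).
  { unfold height. apply Rmult_le_reg_r with (1 - norm2 n x); [lra|].
    unfold Rdiv at 2. rewrite Rmult_assoc, Rinv_l by lra. nra. }
  assert (HKk : K * k <= eta * l / 4).
  { apply Rmult_le_compat_l with (r := K) in Hke; [|lra].
    replace (K * (eta * l / (4 * K))) with (eta * l / 4) in Hke by (field; lra). exact Hke. }
  assert (0 < eta * l) by now apply Rmult_lt_0_compat. nra.
Qed.

(** The one-sided form can be applied to both [u] and [- u]. The maximum point of [u] over the
    barrier could be interior, on the cutting hypersurface, or on the boundary of the domain; each
    case is contradictory. *)
Lemma subsolution_nonpos (n : nat) (O : point -> Prop) (p : point) (lam : R) (u : point -> R) g h :
  (2 <= n)%nat -> (forall x, O x -> Hn n x) -> open_in_Rn n O -> ideal_pt n p ->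
  (forall q, boundary_inf n O q -> forall i, q i = p i) ->
  lam <= (INR n - 1)^2 / 4 ->
  (exists M, forall x, O x -> u x <= M) ->
  continuous_on n (closureH n O) u -> C2_on n O u g h ->
  (forall x, O x -> - hyp_laplacian n g h x = lam * u x) ->
  (forall x, boundaryH n O x -> u x = 0) ->
  forall x, O x -> u x <= 0.
Proof.
  intros Hn2 HOH Hopen [_ Hp] Hinf Hlam [M HM] Hcont HC2 Heq Hbd x0 HO0.
  apply Rnot_lt_le. intros Hu0.
  apply le_INR in Hn2. simpl in Hn2.
  set (b := (INR n - 1) / 2). assert (Hb : 0 < b) by (unfold b; lra).
  assert (Hlamb : lam <= b^2) by (unfold b; lra).
  pose proof (HM x0 HO0) as HM0.
  destruct (HOH x0 HO0) as [_ Hx0].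
  destruct (small_barrier b M (u x0) Hb Hu0 ltac:(lra)) as [eta [[Heta Heta1] Hsmall]].
  set (K := 2 * b * (b + 1) + 1).
  assert (HK : 1 <= K) by (unfold K; nra).
  destruct (height_lower_bound n p x0 K eta Hp Hx0 ltac:(lra) Heta)
    as [k [be [Hk [Hbe1 [Hbe Hh0]]]]].
  assert (HkK : k <= K * k) by nra.
  assert (Hh0' : K * k < height n be p x0) by nra.
  specialize (Hsmall k (K * k) (height n be p x0) Hk HkK Hh0).
  (* Multiplying [height - K k] by [1 - |x|^2] gives a polynomial that makes sense on the unit
     sphere too, so [D] is closed in the whole of R^n. *)
  set (Phi := fun x => 1 + norm2 n x - 2 * be * dot n p x + - (K * k * (1 - norm2 n x))).
  set (D := fun x => closureE n O x /\ 0 <= Phi x).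
  assert (HPhi : forall x, norm2 n x < 1 -> (0 <= Phi x <-> K * k <= height n be p x)).
  { intros x Hx. unfold Phi.
    assert (Heq' : height n be p x * (1 - norm2 n x) = 1 + norm2 n x - 2 * be * dot n p x)
      by (unfold height; field; lra).
    rewrite <- Heq'. split; intros H; [|nra].
    apply Rmult_le_reg_r with (1 - norm2 n x); lra. }
  assert (HD : forall x, D x -> closureH n O x /\ K * k <= height n be p x).
  { intros x [Hcl HP]. pose proof (closureE_norm2 n O x HOH Hcl) as Hle.
    (* The closure meets the unit sphere only at [p], where [Phi] equals [2 - 2 be < 0]; hence [D]
       is compact inside H^n. *)
    assert (Hlt : norm2 n x < 1).
    { destruct Hle as [|Hx1]; [assumption|exfalso].
      assert (Hxp : forall i, x i = p i).
      { apply Hinf. split; [split|]; try assumption. apply Hcl. }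
      assert (Hdot : dot n p x = 1).
      { rewrite <- Hp. apply rsum_ext. intros i _. rewrite Hxp. ring. }
      unfold Phi in HP. rewrite Hx1, Hdot in HP. lra. }
    split; [|now apply HPhi]. split; [split|]; try assumption. apply Hcl. }
  assert (HOD : forall x, O x -> K * k <= height n be p x -> D x).
  { intros x Hx Hhx. split; [now apply closureE_incl|]. apply HPhi; [apply HOH, Hx|assumption]. }
  assert (HFpos : forall x, K * k <= height n be p x -> 0 < profile b k (height n be p x)).
  { intros x Hx. destruct (profile_bounds b k (height n be p x) Hk ltac:(lra)) as [H _].
    pose proof (exp_pos (- b * ln (height n be p x))). lra. }
  destruct (compact_max n D (fun x => u x / profile b k (height n be p x))) as [z [HDz Hmax]].
  - exists x0. apply HOD; [assumption|lra].
  - intros x Hx. split; [apply Hx|]. now apply (closureE_norm2 n O x HOH), Hx.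
  - apply closed_inter; [apply closed_closureE|]. apply closed_ge0. unfold Phi.
    repeat apply continuous_on_plus; try apply continuous_on_opp;
    repeat apply continuous_on_mult; try apply continuous_on_const;
    repeat apply continuous_on_plus; try apply continuous_on_opp;
    try apply continuous_on_const; try apply norm2_continuous; apply dot_continuous.
  - apply continuous_on_div.
    + intros x Hx. apply Rgt_not_eq, HFpos, HD, Hx.
    + apply continuous_on_subset with (2 := Hcont). intros x Hx. apply HD, Hx.
    + apply (continuous_on_comp n D (profile b k)).
      * intros x Hx. apply derivable_continuous_pt.
        exists (profile' b k (height n be p x)). apply profile_derivative.
        destruct (HD x Hx) as [_ H]. lra.
      * apply continuous_on_subset with (2 := height_continuous n be p).
        intros x Hx. apply HD, Hx.
  - destruct (HD z HDz) as [HzH Hzh]. pose proof (HFpos z Hzh) as HFz.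
    pose proof (HFpos x0 ltac:(lra)) as HF0.
    pose proof (Hmax x0 (HOD x0 HO0 ltac:(lra))) as Hmax0. cbv beta in Hmax0.
    assert (Hv0 : 0 < u x0 / profile b k (height n be p x0)) by now apply Rdiv_lt_0_compat.
    destruct (classic (O z)) as [HOz|HnOz].
    + destruct Hzh as [Hlt|Hzk].
      * apply (no_interior_touching n O u g h lam b k be p z
          (u z / profile b k (height n be p z))); try assumption; try reflexivity.
        -- now apply Heq.
        -- lra.
        -- intros y HOy Hhy. fold K in Hhy.
           pose proof (Hmax y (HOD y HOy ltac:(lra))) as Hy. cbv beta in Hy.
           pose proof (HFpos y ltac:(lra)) as HFy.
           apply Rmult_le_compat_r with (r := profile b k (height n be p y)) in Hy; [|lra].
           replace (u y) with (u y / profile b k (height n be p y)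
             * profile b k (height n be p y)) by (field; lra). exact Hy.
        -- field. lra.
      (* On the hypersurface [u z <= M], and [Hsmall] then makes the ratio at [z] smaller than the
         ratio at [x0]; the comparison is done after clearing denominators. *)
      * rewrite <- Hzk in *.
        apply Rmult_le_compat_r with
          (r := profile b k (height n be p x0) * profile b k (K * k)) in Hmax0; [|apply Rmult_le_pos; lra].
        replace (u x0 / _ * _) with (u x0 * profile b k (K * k)) in Hmax0 by (field; lra).
        replace (u z / _ * _) with (u z * profile b k (height n be p x0)) in Hmax0
          by (field; lra).
        pose proof (HM z HOz). nra.
    + rewrite (Hbd z (conj HzH HnOz)) in Hmax0. unfold Rdiv at 2 in Hmax0. lra.
Qed.

Theorem mainTheorem5 (n : nat) (O : point -> Prop) (p : point)
  (hn : (2 <= n)%nat)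
  (hO : domain_Hn n O) (hpid : ideal_pt n p)
  (hp : forall q, boundary_inf n O q <-> (ideal_pt n q /\ forall i, q i = p i))
  (lam : R) (hlam0 : 0 <= lam) (hlam1 : lam <= (INR n - 1)^2 / 4)
  (u : point -> R)
  (hbdd : exists M, forall x, O x -> Rabs (u x) <= M)
  (hcont : continuous_on n (closureH n O) u)
  (hC2 : exists g h, C2_on n O u g h /\
           forall x, O x -> - hyp_laplacian n g h x = lam * u x)
  (hbd : forall x, boundaryH n O x -> u x = 0) :
  forall x, O x -> u x = 0.
Proof.
  destruct hO as [HOH [_ [Hopen _]]], hbdd as [M HM], hC2 as [g [h [[Hu HC2] Heq]]].
  assert (Hinf : forall q, boundary_inf n O q -> forall i, q i = p i)
    by (intros q Hq; apply hp, Hq).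
  intros x HOx. apply Rle_antisym.
  - apply (subsolution_nonpos n O p lam u g h); try assumption.
    + exists M. intros y Hy. specialize (HM y Hy). apply Rabs_le_between in HM. lra.
    + now split.
  (* The equation and the boundary condition are linear, so [- u] with negated partials satisfies
     the same hypotheses. *)
  - assert (- u x <= 0); [|lra].
    apply (subsolution_nonpos n O p lam (fun y => - u y) (fun i y => - g i y)
      (fun i j y => - h i j y)); try assumption.
    + exists M. intros y Hy. specialize (HM y Hy). apply Rabs_le_between in HM. lra.
    + now apply continuous_on_opp.
    + split; [now apply continuous_on_opp|]. intros i Hi.
      destruct (HC2 i Hi) as [Hg [Hgc Hh]]. split; [|split; [now apply continuous_on_opp|]].
      * intros y Hy. now apply derivable_pt_lim_opp, Hg.
      * intros j Hj. destruct (Hh j Hj) as [Hh1 Hh2].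
        split; [|now apply continuous_on_opp].
        intros y Hy. now apply derivable_pt_lim_opp, Hh1.
    + intros y Hy. specialize (Heq y Hy). unfold hyp_laplacian in *.
      rewrite (rsum_ext n (fun i => - h i i y) (fun i => -1 * h i i y)) by (intros; ring).
      rewrite (rsum_ext n (fun i => y i * - g i y) (fun i => -1 * (y i * g i y)))
        by (intros; ring).
      rewrite !rsum_scal. lra.
    + intros y Hy. rewrite (hbd y Hy). ring.
Qed.
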